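(* Let $(a_n)$ be an arithmetic sequence of positive integers, and let $(d_n)$ be the non-arithmetic sequence associated with $(a_n)$. If $(a_n)$ is $b$-bounded, then $t^s_{(a_n)}(\mathbb{T})=t^s_{(d_n)}(\mathbb{T})$.
   Context: $\mathbb{T}=\mathbb{R}/\mathbb{Z}$ is the circle group; for real $x$, $\|x\|$ denotes the distance from $x$ to the nearest integer (this is well defined on $\mathbb{T}$). Arithmetic sequence: a sequence of positive integers $(a_n)_{n\ge 0}$ with $1=a_0<a_1<a_2<\cdots$ and $a_n\mid a_{n+1}$ for every $n$. Its ratios are $b_n=a_n/a_{n-1}$ for $n\ge 1$ (integers $\ge 2$). The sequence $(a_n)$ is called $b$-bounded if $(b_n)$ is bounded. Associated sequence: $(d_n)_{n\ge 1}$ is the increasing enumeration of the set $\{r a_k : k\ge 0,\ 1\le r<b_{k+1}\}$. Density: for $A\subseteq\mathbb{N}$, $\overline{d}(A)=\limsup_{n\to\infty}\frac{|A\cap[0,n-1]|}{n}$ and $\underline{d}(A)=\liminf_{n\to\infty}\frac{|A\cap[0,n-1]|}{n}$; if they are equal the common value is the natural density $d(A)$. For a sequence of integers $(u_n)$, the statistically characterized subgroup is $t^s_{(u_n)}(\mathbb{T})=\{x\in\mathbb{T}: u_nx\to 0 \text{ statistically}\}$, where $u_nx\to0$ statistically means that for every $\varepsilon>0$ the set $\{n:\|u_nx\|\ge\varepsilon\}$ has natural density $0$. *)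

(* Defs.v *)
From HB Require Import structures.
From mathcomp Require Import all_boot all_order all_algebra.
From mathcomp Require Import generic_quotient ring_quotient finmap.
From mathcomp Require Import all_classical all_reals all_analysis.
Set Implicit Arguments.
Unset Strict Implicit.
Unset Printing Implicit Defensive.
Import Order.TTheory GRing.Theory Num.Theory.
Local Open Scope classical_set_scope.
Local Open Scope quotient_scope.
Local Open Scope ring_scope.

(* The predicate underlying the qualifier Num.int. *)
Definition int_subgroup (R : realType) : zmodClosed R :=
  GRing.ZmodClosed.clone R Num.int_num_subdef _.

(* The quotient group R / Z; being a zmodType it has integer multiples x *~ k. *)
Notation circle R := (Quotient.quot (int_subgroup R)).

Definition dist_int (R : realType) (x : R) : R :=
  inf [set `|x - k%:~R| | k in [set: int]].

Definition circle_norm (R : realType) (x : circle R) : R := dist_int (repr x).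

Lemma dist_intD (R : realType) (x : R) (k : int) :
  dist_int (x + k%:~R) = dist_int x.
Proof.
congr (inf _); apply/seteqP; split => _ [j _ <-] /=.
  by exists (j - k) => //; rewrite intrB opprB addrA.
by exists (j + k) => //; rewrite intrD opprD addrACA subrr addr0.
Qed.

Lemma circle_normE (R : realType) (x : R) :
  circle_norm (\pi_(circle R) x) = dist_int x.
Proof.
have : (repr (\pi_(circle R) x) - x) \in int_subgroup R.
  by rewrite Quotient.idealrBE reprK.
move=> /intrP[k Dk]; rewrite /circle_norm.
by rewrite -[repr _](subrK x) Dk addrC dist_intD.
Qed.

Section density.
Context {R : realType}.
Local Open Scope ereal_scope.

Definition count_ratio (A : set nat) (n : nat) : \bar R :=
  ((#|` fset_set (A `&` `I_n)|)%:R / n%:R)%R%:E.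

Definition upper_density (A : set nat) : \bar R := limn_esup (count_ratio A).
Definition lower_density (A : set nat) : \bar R := limn_einf (count_ratio A).

Definition has_density (A : set nat) (l : R) : Prop :=
  upper_density A = l%:E /\ lower_density A = l%:E.

End density.

(* The argument m is the first index: (v_n) is indexed by n >= m, and the
   values v n for n < m are irrelevant. *)
Definition stat_cvg0 (R : realType) (m : nat) (v : nat -> circle R) : Prop :=
  forall e : R, 0 < e ->
    has_density [set n | (m <= n)%N /\ e <= circle_norm (v n)] (0 : R).

Definition stat_char_subgroup (R : realType) (m : nat) (u : nat -> int) :
    set (circle R) :=
  [set x | stat_cvg0 m (fun n => x *~ u n)].

Local Open Scope nat_scope.

Definition arithmetic_seq (a : nat -> nat) : Prop :=
  [/\ a 0 = 1, forall n, a n < a n.+1 & forall n, a n %| a n.+1].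

(* Meaningful for n >= 1 only. *)
Definition seq_ratio (a : nat -> nat) (n : nat) : nat := a n %/ a n.-1.

Definition b_bounded (a : nat -> nat) : Prop :=
  exists M, forall n, 1 <= n -> seq_ratio a n <= M.

Definition assoc_set (a : nat -> nat) : set nat :=
  [set m | exists k r, 1 <= r < seq_ratio a k.+1 /\ m = r * a k].

(* (d_n) for n >= 1 is the increasing enumeration of assoc_set a; the value
   d 0 is irrelevant. *)
Definition assoc_seq (a d : nat -> nat) : Prop :=
  (forall n, 1 <= n -> d n < d n.+1) /\
  [set d n | n in [set n | 1 <= n]] = assoc_set a.

(* Main.v *)
Require Import Defs.
From mathcomp Require Import all_boot all_order all_algebra.
From mathcomp Require Import finmap.
From mathcomp Require Import all_classical all_reals all_analysis.
From mathcomp Require Import ring.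

(** Write b for the ratios of a and let M bound them. The associated sequence
    d runs through consecutive blocks a_k, 2 a_k, ..., (b_(k+1) - 1) a_k; every
    block is nonempty and has fewer than M terms. Hence the position p k of a_k
    in d satisfies k < p k <= (k + 1) M (lemmas [ltn_position] and
    [position_leq]): passing from the index of d to the index of the block
    changes indices by a bounded factor only, and this preserves sets of
    density zero.

    If d_n x -> 0 statistically, the bad indices k of the sequence a_k x are
    carried injectively by p to bad indices of d_n x. Conversely, if d_n lies
    in the block of a_k, say d_n = r a_k with r < M, then
    ||d_n x|| <= r ||a_k x||, so a bad index n at level e gives a bad index k
    at level e / M, and each k is reached from fewer than M indices n. Both
    transfers are instances of [density0_transfer], which rests on the
    pigeonhole bound [leq_size_fibers]. *)

Import Order.TTheory GRing.Theory Num.Theory.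
Local Open Scope classical_set_scope.

(** * Sets of density zero *)

(** The labels g, taking at most M values, separate the points in each fibre
    of f, so the fibres have at most M points. *)
Lemma leq_size_fibers (s t : seq nat) (f g : nat -> nat) (M : nat) :
  uniq s ->
  (forall i, i \in s -> f i \in t /\ g i < M) ->
  (forall i j, i \in s -> j \in s -> f i = f j -> g i = g j -> i = j) ->
  size s <= size t * M.
Proof.
move=> us st inj; rewrite -(size_map (fun i => (f i, g i))).
rewrite -[X in _ * X](size_iota 0) -(size_allpairs pair).
apply: uniq_leq_size.
  by rewrite map_inj_in_uniq// => i j si sj [fij gij]; exact: inj.
move=> _ /mapP[i /st[ti gi] ->].
by apply: allpairs_f => //; rewrite mem_iota.
Qed.

Lemma mem_fset_setI_II (A : set nat) (n i : nat) :
  reflect (A i /\ i < n) (i \in fset_set (A `&` `I_n)).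
Proof.
rewrite in_fset_set; last by apply: finite_setIr; exact: finite_II.
by apply: (iffP idP); rewrite inE.
Qed.

Lemma count_ratio_ge0 (R : realType) (A : set nat) (n : nat) :
  (0 <= count_ratio (R := R) A n)%E.
Proof. by rewrite lee_fin divr_ge0. Qed.

Lemma has_density0P (R : realType) (A : set nat) :
  has_density A (0 : R)%R <-> count_ratio (R := R) A @ \oo --> 0%E.
Proof.
split=> [[A0 _]|A0]; last by split; case: (cvg_limn_einf_sup A0).
apply: limn_esup_le_cvg; last exact: count_ratio_ge0.
by rewrite -[leLHS]/(upper_density A) A0.
Qed.

(** A set that maps into B with fibres of bounded size, by a map that
    increases indices by a bounded factor at most, is no denser than B up to
    a constant. *)
Lemma density0_transfer (R : realType) (A B : set nat) (f g : nat -> nat)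
    (L M : nat) :
  0 < L ->
  (forall i, A i -> [/\ B (f i), f i < i.+1 * L & g i < M]) ->
  (forall i j, A i -> A j -> f i = f j -> g i = g j -> i = j) ->
  has_density B (0 : R)%R -> has_density A (0 : R)%R.
Proof.
move=> L0 AB inj /has_density0P B0; apply/has_density0P.
pose h n := ((M * L)%:R%:E * count_ratio (R := R) B (n * L))%E.
apply: (@squeeze_cvge _ _ _ _ (cst 0%E) _ h).
- apply: nearW => n; rewrite count_ratio_ge0 /=.
  rewrite /h /count_ratio -EFinM lee_fin.
  (* At n = 0 both sides vanish, the inverse of 0 being 0. *)
  have [->|n0] := posnP n; first by rewrite mul0n !invr0 !mulr0.
  rewrite ler_pdivrMr ?ltr0n// natrM natrM.
  have -> : (M%:R * L%:R * (#|` fset_set (B `&` `I_(n * L))|%:R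
      / (n%:R * L%:R)) * n%:R
      = (#|` fset_set (B `&` `I_(n * L))| * M)%:R :> R)%R.
    rewrite natrM; field.
    by rewrite !pnatr_eq0 -!lt0n n0 L0.
  rewrite ler_nat.
  apply: (@leq_size_fibers _ _ f g).
  + exact: fset_uniq.
  + move=> i /mem_fset_setI_II[Ai ltin]; have [Bfi lt_fi gi] := AB i Ai.
    split=> //; apply/mem_fset_setI_II; split=> //.
    by apply: leq_trans lt_fi _; rewrite leq_mul2r ltin orbT.
  + by move=> i j /mem_fset_setI_II[Ai _] /mem_fset_setI_II[Aj _]; exact: inj.
- exact: cvg_cst.
- rewrite -(mule0 (M * L)%:R%:E); apply: cvgeZl => //.
  apply: (cvg_comp (fun n => n * L) (count_ratio (R := R) B) _ B0).
  exact: (cvg_mulnr _ L0).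
Qed.

(** * The norm of the circle *)

(** Multiplying an integer near y by r gives an integer near r y. *)
Lemma dist_int_mulrn (R : realType) (y : R) (r : nat) :
  (dist_int (y *+ r) <= r%:R * dist_int y)%R.
Proof.
have lb z : has_lbound [set `|z - k%:~R|%R | k in [set: int]].
  by exists 0%R => _ [k _ <-]; exact: normr_ge0.
have [->|r0] := posnP r.
  rewrite mul0r mulr0n; apply: ge_inf; first exact: lb.
  by exists (0%R : int) => //; rewrite subr0 normr0.
rewrite mulrC -ler_pdivrMr ?ltr0n//; apply: lb_le_inf.
  by exists `|y - 0%:~R|%R; exists (0%R : int).
move=> _ [k _ <-]; rewrite ler_pdivrMr ?ltr0n//.
apply: ge_inf; first exact: lb.
exists (k *+ r)%R => //.
by rewrite rmorphMn/= -mulrnBl normrMn mulr_natr.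
Qed.

Lemma circle_norm_mulrn (R : realType) (x : circle R) (r : nat) :
  (circle_norm (x *+ r) <= r%:R * circle_norm x)%R.
Proof.
rewrite -[x in leLHS]reprK -raddfMn circle_normE.
exact: dist_int_mulrn.
Qed.

(** * Positions in the associated sequence *)

Section positions.
Variables (a d : nat -> nat) (M : nat).
Hypothesis ha : arithmetic_seq a.
Hypothesis hd : assoc_seq a d.
Hypothesis hM : forall n, 1 <= n -> seq_ratio a n <= M.

Lemma arithmetic_seq_homo : {homo a : j k / j < k}.
Proof. by case: ha => _ a_lt _; apply: homo_ltn => //; exact: ltn_trans. Qed.

Lemma arithmetic_seq_mono : {mono a : j k / j <= k}.
Proof. exact: leq_mono arithmetic_seq_homo. Qed.

Lemma arithmetic_seq_gt0 k : 0 < a k.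
Proof.
by case: ha => a0 _ _; rewrite -a0 arithmetic_seq_mono.
Qed.

Lemma seq_ratio_gt1 k : 1 < seq_ratio a k.+1.
Proof.
case: ha => _ a_lt a_dvd; rewrite /seq_ratio /=.
by rewrite ltn_divRL// mul1n.
Qed.

Lemma assoc_set_arithmetic k : assoc_set a (a k).
Proof. by exists k, 1; rewrite seq_ratio_gt1 mul1n. Qed.

Lemma assoc_seq_homo m n : 1 <= m -> m < n -> d m < d n.
Proof.
move=> m1; case: hd => d_lt _; elim: n => // n IHn.
rewrite ltnS leq_eqVlt => /predU1P[<-|mn]; first exact: d_lt.
by apply: ltn_trans (IHn mn) (d_lt _ _); exact: leq_trans m1 (ltnW mn).
Qed.

Lemma assoc_seq_mono m n : 1 <= m -> 1 <= n -> (d m <= d n) = (m <= n).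
Proof.
move=> m1 n1; case: leqP => [le_d|lt_d].
  rewrite leqNgt; apply/esym/negP => /(assoc_seq_homo _ _ n1).
  by rewrite ltnNge le_d.
apply/esym/negbTE; rewrite -ltnNge ltnNge; apply/negP.
rewrite leq_eqVlt => /predU1P[mn|/(assoc_seq_homo _ _ m1)].
  by rewrite mn ltnn in lt_d.
by rewrite ltnNge ltnW.
Qed.

Lemma assoc_seq_inj m n : 1 <= m -> 1 <= n -> d m = d n -> m = n.
Proof.
move=> m1 n1 dmn; apply/eqP.
by rewrite eqn_leq -(assoc_seq_mono m n)// -(assoc_seq_mono n m)// dmn leqnn.
Qed.

Lemma exists_position :
  {p : nat -> nat & forall k, 1 <= p k /\ d (p k) = a k}.
Proof.
apply: (@choice _ _ (fun k n => 1 <= n /\ d n = a k)) => k; case: hd => _ d_img.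
have : assoc_set a (a k) by exact: assoc_set_arithmetic.
by rewrite -d_img => -[n n1 dn]; exists n.
Qed.

Lemma exists_block :
  {fg : nat -> nat * nat & forall n, 1 <= n ->
    d n = (fg n).2 * a (fg n).1 /\ 1 <= (fg n).2 < M}.
Proof.
apply: (@choice _ _ (fun n (fg : nat * nat) => 1 <= n ->
  d n = fg.2 * a fg.1 /\ 1 <= fg.2 < M)) => n.
have [n1|] := leqP 1 n; last by exists (0, 0).
case: hd => _ d_img.
have : assoc_set a (d n) by rewrite -d_img; exists n.
move=> [k [r [/andP[r1 rb] dn]]]; exists (k, r) => _; split=> //=.
by rewrite r1 (leq_trans rb)// hM.
Qed.

Variable p : nat -> nat.
Hypothesis hp : forall k, 1 <= p k /\ d (p k) = a k.

(** Each of a_0, ..., a_k occurs in d, in this order, and positions in d start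
    at 1. *)
Lemma ltn_position k : k < p k.
Proof.
elim: k => [|k IHk]; first by case: (hp 0).
apply: leq_ltn_trans IHk _; rewrite ltnNge.
have [pk1 dpk] := hp k; have [pk1' dpk'] := hp k.+1.
by rewrite -assoc_seq_mono// dpk dpk' -ltnNge arithmetic_seq_homo.
Qed.

Variable fg : nat -> nat * nat.
Hypothesis hfg : forall n, 1 <= n ->
  d n = (fg n).2 * a (fg n).1 /\ 1 <= (fg n).2 < M.

Lemma block_inj m n : 1 <= m -> 1 <= n ->
  (fg m).1 = (fg n).1 -> (fg m).2 = (fg n).2 -> m = n.
Proof.
move=> m1 n1 fmn gmn; apply: assoc_seq_inj => //.
have [-> _] := hfg m m1; have [-> _] := hfg n n1.
by rewrite fmn gmn.
Qed.

Lemma arithmetic_block_leq n : 1 <= n -> a (fg n).1 <= d n.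
Proof. by move=> n1; have [-> /andP[g1 _]] := hfg n n1; rewrite leq_pmull. Qed.

Lemma block_ltn n : 1 <= n -> (fg n).1 < n.
Proof.
move=> n1; apply: leq_trans (ltn_position _) _.
have [p1 dp] := hp (fg n).1.
by rewrite -assoc_seq_mono// dp arithmetic_block_leq.
Qed.

(** The first p k terms of d are at most a_k, so they are multiples r a_j with
    j <= k and r < M. *)
Lemma position_leq k : p k <= k.+1 * M.
Proof.
rewrite -{1}(size_iota 1 (p k)) -(size_iota 0 k.+1).
apply: (@leq_size_fibers _ _ (fun n => (fg n).1) (fun n => (fg n).2)).
- exact: iota_uniq.
- move=> n; rewrite mem_iota mem_iota add1n ltnS => /andP[n1 n_le].
  have [_ /andP[_ gM]] := hfg n n1; split=> //.
  rewrite add0n ltnS /= -arithmetic_seq_mono.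
  apply: leq_trans (arithmetic_block_leq n n1) _.
  by have [p1 <-] := hp k; rewrite assoc_seq_mono.
- move=> m n; rewrite !mem_iota => /andP[m1 _] /andP[n1 _].
  exact: block_inj.
Qed.

End positions.

Theorem theorem2p5 (R : realType) (a d : nat -> nat)
    (ha : arithmetic_seq a) (hd : assoc_seq a d) (hb : b_bounded a) :
  stat_char_subgroup (R := R) 0%N (fun n => Posz (a n)) =
  stat_char_subgroup (R := R) 1%N (fun n => Posz (d n)).
Proof.
case: hb => M hM.
have [p hp] := exists_position a d ha hd.
have [fg hfg] := exists_block a d M hd hM.
have M0 : 0 < M.
  by apply: leq_trans (hM 1 isT); apply: ltnW; exact: seq_ratio_gt1.
apply/seteqP; split=> x xt e e0.
- have eM0 : (0 < e / M%:R)%R by rewrite divr_gt0 ?ltr0n.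
  apply: (density0_transfer _ _ _ (fun n => (fg n).1) (fun n => (fg n).2)
    1 M isT) (xt _ eM0).
  + move=> n [n1 le_e]; have [dn /andP[g1 gM]] := hfg n n1.
    split=> //; last first.
      by rewrite muln1 (leq_trans (block_ltn _ _ _ ha hd _ hp _ hfg n n1)).
    split=> //; move: le_e; rewrite /= dn mulnC.
    set y := (x *~ a (fg n).1)%R.
    have -> : (x *~ Posz (a (fg n).1 * (fg n).2) = y *+ (fg n).2)%R.
      by rewrite PoszM mulrzA.
    move=> /le_trans/(_ (circle_norm_mulrn _ y _)) le_e.
    have y0 : (0 < circle_norm y)%R.
      by rewrite -(@pmulr_rgt0 _ (fg n).2%:R) ?ltr0n// (lt_le_trans e0).
    rewrite ler_pdivrMr ?ltr0n//; apply: (le_trans le_e).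
    by rewrite mulrC ler_pM2l// ler_nat ltnW.
  + move=> m n [m1 _] [n1 _].
    exact: (block_inj a d M hd fg hfg).
- (* The strict index bound asked by the transfer costs one more than M. *)
  apply: (density0_transfer _ _ _ p (fun=> 0) M.+1 1 isT) (xt _ e0).
  + move=> k [_ le_e]; have [p1 dp] := hp k; split=> //.
      by rewrite /= dp.
    apply: leq_ltn_trans (position_leq _ _ _ ha hd p hp fg hfg k) _.
    by rewrite ltn_mul2l ltnSn.
  + move=> j k _ _ pjk _; apply/eqP; rewrite eqn_leq.
    rewrite -(arithmetic_seq_mono a ha j k) -(arithmetic_seq_mono a ha k j).
    have [_ <-] := hp j; have [_ <-] := hp k.
    by rewrite pjk leqnn.
Qed.
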